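(* Let $0\le k\le n$ and let $\psi: D^{n-k}\times[0,1]_t\to\mathbb{R}^{2(n-k)+1}$ be a Legendrian isotopy, starting at the standard inclusion of the Legendrian disk $D^{n-k}\times\{0\}\subset \mathbb{R}^{n-k}\times\mathbb{R}^{n-k+1}$, which is the identity (i.e. equal to this inclusion for all $t$) near $\partial D^{n-k}$ and is $t$-independent near $\partial[0,1]$. Then its $D^k$-suspension $\Sigma_{D^k}\{\psi\}$ is a Legendrian in $\mathbb{R}^{2n+1}$, and it is Legendrian isotopic to $D^k\times D^{n-k}$ relative to the boundary.
   Context: Coordinates: $\mathbb{R}^{2n+1}$ has coordinates $x_1,\dots,x_n,y_1,\dots,y_n,z$ and contact form $\alpha=dz-\sum_{i=1}^n y_i\,dx_i$. Write $\mathbb{R}^{2n+1}=\mathbb{R}^{2k}\times\mathbb{R}^{2(n-k)+1}\cong T^*\mathbb{R}^k\times\mathbb{R}^{2(n-k)+1}$, where $\mathbb{R}^{2k}$ has coordinates $x_1,\dots,x_k,y_1,\dots,y_k$ and $\mathbb{R}^{2(n-k)+1}$ has coordinates $x_{k+1},\dots,x_n,y_{k+1},\dots,y_n,z$ and contact form $\alpha_{n-k}=dz-\sum_{i=k+1}^n y_i\,dx_i$. $D^j$ is the closed $j$-disk. $D^k\times D^{n-k}$ denotes the Legendrian with boundary $D^k\times\{0\}\times D^{n-k}\times\{0\}\subset\mathbb{R}^k_{x_1,\dots,x_k}\times\mathbb{R}^k_{y_1,\dots,y_k}\times\mathbb{R}^{n-k}_{x_{k+1},\dots,x_n}\times\mathbb{R}^{n-k+1}_{y_{k+1},\dots,y_n,z}$.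 Fix a smooth bump function $\beta_k:D^k\to[0,1]$ which has a unique critical point, a maximum at $0$ with $\beta_k(0)=1$; is radially symmetric, i.e. $\beta_k(t)=\beta_k(t')$ whenever $|t|=|t'|$; and satisfies $\beta_k|_{\partial D^k}\equiv0$. The $D^k$-suspension $\Sigma_{D^k}\{\psi\}$ is the unique Legendrian lift of $$\left\{\left(s,\psi(\theta,\beta_k(s))\right)\;:\;s\in D^k,\ \theta\in D^{n-k}\right\}\subset\mathbb{R}^k\times\mathbb{R}^{2(n-k)+1}$$ under the projection $\Pi:T^*\mathbb{R}^k\times\mathbb{R}^{2(n-k)+1}\to\mathbb{R}^k\times\mathbb{R}^{2(n-k)+1}$ that forgets $y_1,\dots,y_k$ (the coordinates $y_1,\dots,y_k$ are recovered from the Legendrian condition). ''Legendrian isotopic relative to the boundary'' means there is an isotopy through Legendrian embeddings fixing the boundary pointwise. *)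

(* Defs.v *)
From HB Require Import structures.
From mathcomp Require Import all_boot all_order all_algebra.
From mathcomp Require Import all_classical all_reals all_analysis.

Set Implicit Arguments.
Unset Strict Implicit.
Unset Printing Implicit Defensive.

Import Order.TTheory GRing.Theory Num.Theory.
Import numFieldNormedType.Exports.

Local Open Scope classical_set_scope.
Local Open Scope ring_scope.

Fixpoint Cn (R : realType) (V W : normedModType R) (r : nat)
    (U : set V) (f : V -> W) : Prop :=
  if r is r'.+1 then
    (forall x, U x -> differentiable f x) /\
    (forall v : V, Cn r' U ('D_v f))
  else forall x, U x -> {for x, continuous f}.

(* Smoothness on a subset that need not be open (here: compact domains with
   boundary and corners) means existence of a smooth extension to an open
   neighbourhood. The values of [f] off [A] are irrelevant. *)
Definition smooth_on (R : realType) (V W : normedModType R)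
    (A : set V) (f : V -> W) : Prop :=
  exists (U : set V) (F : V -> W),
    [/\ open U, A `<=` U, forall r, Cn r U F & forall x, A x -> F x = f x].

(* [l] is the differential at [x] of the restriction of [f] to [A]. The library
   differential ['d f x] would depend on the values of [f] off [A]. It is unique
   when [A] is convex with nonempty interior, as all domains below are, and for
   [f] smooth on [A] it is the differential of any smooth extension. *)
Definition has_differential_on (R : realType) (V W : normedModType R)
    (A : set V) (f : V -> W) (x : V) (l : {linear V -> W}) : Prop :=
  continuous l /\
  (fun y : V => `|y - x|^-1 *: (f y - f x - l (y - x))) @ within A x^'
    --> (0 : W).

Section ContactSpace.
Variable R : realType.
Implicit Types m n k : nat.

(* The library norm on row vectors is the sup norm. *)
Definition euclidean_norm m (x : 'rV[R]_m) : R :=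
  Num.sqrt (\sum_(i < m) x 0 i ^+ 2).

Definition disk m : set 'rV[R]_m := [set x | euclidean_norm x <= 1].

Definition sphere m : set 'rV[R]_m := [set x | euclidean_norm x = 1].

Arguments disk : clear implicits.
Arguments sphere : clear implicits.

Definition unit_interval : set R := `[0, 1].

(* R^(2m+1), a point being ((x, y), z). *)
Local Notation space m := ('rV[R]_m * 'rV[R]_m * R)%type.

Definition xcoord m (p : space m) : 'rV[R]_m := p.1.1.
Definition ycoord m (p : space m) : 'rV[R]_m := p.1.2.
Definition zcoord m (p : space m) : R := p.2.

(* alpha = dz - sum_i y_i dx_i at the point [p], applied to the vector [v]. *)
Definition alpha m (p v : space m) : R :=
  zcoord v - \sum_(i < m) ycoord p 0 i * xcoord v 0 i.

(* R^m x {0} in R^m x R^(m+1). *)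
Definition std_inclusion m (x : 'rV[R]_m) : space m := (x, 0, 0).

(* Domains lie in R^m and targets in R^(2m+1), so isotropic immersions have
   maximal dimension. *)
Definition isotropic m (A : set 'rV[R]_m) (f : 'rV[R]_m -> space m) : Prop :=
  forall x (l : {linear 'rV[R]_m -> space m}),
    A x -> has_differential_on A f x l -> forall v, alpha (f x) (l v) = 0.

Definition immersive m (A : set 'rV[R]_m) (f : 'rV[R]_m -> space m) : Prop :=
  forall x (l : {linear 'rV[R]_m -> space m}),
    A x -> has_differential_on A f x l -> injective l.

Definition homeo_onto_image m (A : set 'rV[R]_m) (f : 'rV[R]_m -> space m) :
    Prop :=
  {within A, continuous f} /\
  exists g : space m -> 'rV[R]_m,
    {within f @` A, continuous g} /\ (forall x, A x -> g (f x) = x).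

Definition legendrian_embedding m (A : set 'rV[R]_m)
    (f : 'rV[R]_m -> space m) : Prop :=
  [/\ smooth_on A f, immersive A f, homeo_onto_image A f & isotropic A f].

Definition legendrian_isotopy m (A : set 'rV[R]_m)
    (phi : 'rV[R]_m * R -> space m) : Prop :=
  smooth_on (A `*` unit_interval) phi /\
  (forall t, unit_interval t -> legendrian_embedding A (fun x => phi (x, t))).

(* [B] is the boundary of [A]. *)
Definition legendrian_isotopic_rel m (A B : set 'rV[R]_m)
    (f0 f1 : 'rV[R]_m -> space m) : Prop :=
  exists phi : 'rV[R]_m * R -> space m,
    [/\ legendrian_isotopy A phi,
        forall x, A x -> phi (x, 0) = f0 x,
        forall x, A x -> phi (x, 1) = f1 x
      & forall x t, B x -> unit_interval t -> phi (x, t) = f0 x].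

Definition starts_at_inclusion m (psi : 'rV[R]_m * R -> space m) : Prop :=
  forall th, disk m th -> psi (th, 0) = std_inclusion th.

Definition identity_near_boundary m (psi : 'rV[R]_m * R -> space m) : Prop :=
  exists U : set 'rV[R]_m,
    [/\ open U, sphere m `<=` U
      & forall th t, disk m th -> U th -> unit_interval t ->
          psi (th, t) = std_inclusion th].

Definition time_independent_near_ends m (psi : 'rV[R]_m * R -> space m) :
    Prop :=
  exists2 e : R, 0 < e &
    forall th t, disk m th -> unit_interval t ->
      (t <= e -> psi (th, t) = psi (th, 0)) /\
      (1 - e <= t -> psi (th, t) = psi (th, 1)).

Definition critical_point k (beta : 'rV[R]_k -> R) (s : 'rV[R]_k) : Prop :=
  has_differential_on (disk k) beta s (\0 : {linear 'rV[R]_k -> R}).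

Record bump_function k (beta : 'rV[R]_k -> R) : Prop := BumpFunction {
  bump_smooth : smooth_on (disk k) beta;
  bump_range : forall s, disk k s -> 0 <= beta s <= 1;
  bump_critical : forall s, disk k s -> (critical_point beta s <-> s = 0);
  bump_max : forall s, disk k s -> beta s <= beta 0;
  bump_at0 : beta 0 = 1;
  bump_radial : forall s s', disk k s -> disk k s' ->
    euclidean_norm s = euclidean_norm s' -> beta s = beta s';
  bump_boundary : forall s, sphere k s -> beta s = 0
}.

Section Suspension.
Variables (n k : nat) (hkn : (k <= n)%N).

Definition split_coords (x : 'rV[R]_n) : 'rV[R]_(k + (n - k)) :=
  castmx (erefl 1%N, esym (subnKC hkn)) x.

(* (x_1, ..., x_k) and (x_(k+1), ..., x_n). *)
Definition coords_fst (x : 'rV[R]_n) : 'rV[R]_k := lsubmx (split_coords x).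
Definition coords_snd (x : 'rV[R]_n) : 'rV[R]_(n - k) :=
  rsubmx (split_coords x).

(* D^k x D^(n-k) as a subset of R^n = R^k x R^(n-k). *)
Definition disk_prod : set 'rV[R]_n :=
  [set x | disk k (coords_fst x) /\ disk (n - k) (coords_snd x)].

Definition disk_prod_boundary : set 'rV[R]_n :=
  [set x | disk_prod x /\
           (sphere k (coords_fst x) \/ sphere (n - k) (coords_snd x))].

(* The projection forgetting y_1, ..., y_k. *)
Definition front_proj (p : space n) : 'rV[R]_k * space (n - k) :=
  (coords_fst (xcoord p),
   (coords_snd (xcoord p), coords_snd (ycoord p), zcoord p)).

(* [L] is a Legendrian lift, parametrized by (s, theta) in D^k x D^(n-k), of
   (s, theta) |-> (s, psi (theta, beta s)). *)
Definition is_suspension (beta : 'rV[R]_k -> R)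
    (psi : 'rV[R]_(n - k) * R -> space (n - k)) (L : 'rV[R]_n -> space n) :
    Prop :=
  [/\ smooth_on disk_prod L,
      isotropic disk_prod L
    & forall x, disk_prod x ->
        front_proj (L x) =
          (coords_fst x, psi (coords_snd x, beta (coords_fst x)))].

End Suspension.

End ContactSpace.

Arguments disk {R} m.
Arguments sphere {R} m.
Arguments std_inclusion {R m} x.
Arguments disk_prod {R n k} hkn.
Arguments disk_prod_boundary {R n k} hkn.

Notation contact_space R m := ('rV[R]_m * 'rV[R]_m * R)%type.

(* Main.v *)
Require Import Defs.
From HB Require Import structures.
From mathcomp Require Import all_boot all_order all_algebra.
From mathcomp Require Import all_classical all_reals all_analysis.
From mathcomp Require Import ring lra.
Import Order.TTheory GRing.Theory Num.Theory.
Import numFieldNormedType.Exports.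
Local Open Scope classical_set_scope.
Local Open Scope ring_scope.

Set Implicit Arguments.
Unset Strict Implicit.
Unset Printing Implicit Defensive.

(* Write [H = alpha (d psi / dt)]. The lift of [(s, psi (theta, beta s))] has
   [y_i = H (theta, beta s) * d beta / d s_i] for [i <= k]: pairing the contact
   form with [d / d s_i] leaves exactly this condition, because every [psi_t] is
   Legendrian. The lift is an embedding since each [psi_t] is one and [s] is
   recorded in [x_1, ..., x_k]. Replacing [beta] by [(1 - tau) * beta] gives the
   isotopy to the standard disk. On the boundary either [beta = 0] or
   [psi (theta, _)] is constant, so [H = 0] there and nothing moves. *)

(** * Calculus of smooth maps *)

(** The obstacle is that [psi] and [beta] are prescribed only on compact domains with boundary, so
    their derivatives there make sense only through smooth extensions [F] and [B]. The lift and its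
    isotopy are therefore written with [F] and [B]. What is proved does not depend on the choice of
    extension: the domains are convex and contain a small multiple of every vector, so a
    differential along the domain is determined by the restriction, and at the ends of the time
    interval a one-sided segment already determines the time derivative.

    Two points need care. On the boundary of [D^k] the function [beta] vanishes but its gradient
    need not, so the vanishing of [y_1, ..., y_k] there comes from [H]: the relevant time is 0, and
    [psi] is stationary near time 0. And [(1 - tau) * beta] has gradient [(1 - tau)] times that of
    [beta], which puts an extra factor [1 - tau] into the [y] coordinates of the isotopy. *)

Section SmoothCalculus.
Context {R : realType}.

(** Seen as a bilinear map, scaling inherits the differentiation rule for bilinear maps, which is
    the product rule for [k y *: f y]. *)
Lemma scale_bilinear (W : normedModType R) :
  bilinear_for
    (GRing.Scale.Law.clone _ _ ( *:%R : R -> W -> W) _)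
    (GRing.Scale.Law.clone _ _ ( *:%R : R -> W -> W) _)
    ( *:%R : R -> W -> W).
Proof.
split=> [u'|u] a x y /=.
- by rewrite scalerDl scalerA.
- by rewrite scalerDr !scalerA mulrC.
Qed.

HB.instance Definition _ (W : normedModType R) :=
  bilinear_isBilinear.Build R R W W _ _ ( *:%R : R -> W -> W) (@scale_bilinear W).

Lemma is_diff_scale_pair (W : normedModType R) (p : R * W) :
  is_diff p (fun q : R * W => q.1 *: q.2) (fun q => p.1 *: q.2 + q.1 *: p.2).
Proof.
have c : continuous (fun q : R * W => q.1 *: q.2) by move=> ?; exact: scale_continuous.
apply: DiffDef.
  exact: (@differentiable_bilin _ _ _ _ ( *:%R : {bilinear R -> W -> W})).
exact: (@diff_bilin _ _ _ _ ( *:%R : {bilinear R -> W -> W})).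
Qed.

Lemma is_diff_scale (V W : normedModType R) (k : V -> R) (f : V -> W) x :
  differentiable k x -> differentiable f x ->
  is_diff x (fun y => k y *: f y) (fun v => k x *: 'd f x v + 'd k x v *: f x).
Proof.
move=> dk df.
have dp : is_diff x (fun y => (k y, f y)) (fun v => ('d k x v, 'd f x v)).
  exact: is_diff_pair (differentiableP dk) (differentiableP df).
exact: (is_diff_comp dp (is_diff_scale_pair (k x, f x))).
Qed.

Lemma differentiable_le (V W : normedModType R) (f : V -> W) (x : V) :
  differentiable f x -> forall e, 0 < e ->
  \forall y \near x, `|f y - f x - 'd f x (y - x)| <= e * `|y - x|.
Proof.
move=> /diff_locally /eqaddoP df e e0.
rewrite (near_shift 0 x) subr0; apply: filterS (df _ e0) => y /=.
by rewrite /shift /= opprD addrA addrK.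
Qed.

Lemma differentiable_leP (V W : normedModType R) (f : V -> W) (x : V)
    (l : {linear V -> W}) :
  continuous l -> (forall e, 0 < e ->
  \forall y \near x, `|f y - f x - l (y - x)| <= e * `|y - x|) ->
  is_diff x f l.
Proof.
move=> cl H.
have E : f \o shift x = cst (f x) + l +o_ 0 id.
  apply/eqaddoP => e e0; have := H _ e0; rewrite (near_shift 0 x) subr0.
  by apply: filterS => y /=; rewrite /shift /= opprD addrA addrK.
have D := diff_unique cl E.
by apply: DiffDef => //; apply/diff_locallyP; rewrite D.
Qed.

Lemma near_eq_differentiable (V W : normedModType R) (f g : V -> W) (x : V) :
  (\near x, f x = g x) -> differentiable f x -> differentiable g x.
Proof.
move=> fg df.
suff [] : is_diff x g ('d f x) by [].
apply: differentiable_leP; first exact: diff_continuous.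
move=> e e0; have fgx := nbhs_singleton fg.
near=> y.
rewrite -fgx -(near fg y) //.
by near: y; exact: differentiable_le.
Unshelve. all: by end_near. Qed.

(** Since [U] is open, agreement on [U] is agreement near each of its points and passes to
    directional derivatives. The rules below use this to replace a derivative by a formula that is
    valid only on [U]. *)
Lemma Cn_ext (V W : normedModType R) (r : nat) (U : set V) (f g : V -> W) :
  open U -> (forall x, U x -> f x = g x) -> Cn r U f -> Cn r U g.
Proof.
move=> oU; elim: r f g => [|r IH] f g fg /=.
  move=> cf x Ux; have nfg : \forall y \near x, f y = g y.
    by apply: filterS (fg) _; exact: open_nbhs_nbhs.
  have : g y @[y --> x] --> f x.
    by apply: cvg_trans (cf x Ux); apply: near_eq_cvg; apply: filterS nfg.
  by rewrite fg.
move=> [df Df]; have nfg x : U x -> \forall y \near x, f y = g y.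
  by move=> Ux; apply: filterS (fg) _; exact: open_nbhs_nbhs.
split=> [x Ux|v]; first exact: near_eq_differentiable (nfg x Ux) (df x Ux).
apply: IH (Df v) => x Ux; exact/near_eq_derive/nfg.
Qed.

Lemma Cn_continuous (V W : normedModType R) (r : nat) (U : set V) (f : V -> W) x :
  Cn r U f -> U x -> {for x, continuous f}.
Proof. by case: r => [|r] /= => [cf|[df _]] Ux;
  [exact: cf|exact/differentiable_continuous/df]. Qed.

Lemma CnS (V W : normedModType R) (r : nat) (U : set V) (f : V -> W) :
  Cn r.+1 U f -> Cn r U f.
Proof.
elim: r f => [|r IH] f; first by move=> [df _] x Ux; exact/differentiable_continuous/df.
by move=> [df Df]; split=> // v; exact: IH.
Qed.

Lemma Cn_cst (V W : normedModType R) r (U : set V) (a : W) : Cn r U (cst a).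
Proof.
elim: r a => [|r IH] a /=; first by move=> x _; exact: cst_continuous.
split=> [x _|v]; first exact: differentiable_cst.
rewrite (_ : 'D_v _ = cst 0); first exact: IH.
by apply/funext => x; rewrite derive_cst.
Qed.

Lemma Cn_linear (V W : normedModType R) r (U : set V) (l : {linear V -> W}) :
  continuous l -> Cn r U l.
Proof.
move=> cl; case: r => [|r] /=; first by move=> x _; exact: cl.
split=> [x _|v]; first exact: linear_differentiable.
rewrite (_ : 'D_v _ = cst (l v)); first exact: Cn_cst.
by apply/funext => x; rewrite deriveE ?diff_lin//; exact: linear_differentiable.
Qed.

Lemma Cn_add (V W : normedModType R) r (U : set V) (f g : V -> W) : open U ->
  Cn r U f -> Cn r U g -> Cn r U (fun x => f x + g x).
Proof.
move=> oU; elim: r f g => [|r IH] f g /=.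
  by move=> cf cg x Ux; apply: cvgD; [exact: cf|exact: cg].
move=> [df Df] [dg Dg]; split=> [x Ux|v].
  by apply: differentiableD; [exact: df|exact: dg].
apply: (@Cn_ext _ _ _ _ (fun x => 'D_v f x + 'D_v g x)) => //; last exact: IH.
by move=> x Ux; rewrite -deriveD//; apply: diff_derivable; [exact: df|exact: dg].
Qed.

Lemma Cn_sum (V W : normedModType R) r (U : set V) (I : finType) (f : I -> V -> W) :
  open U -> (forall i, Cn r U (f i)) -> Cn r U (fun x => \sum_i f i x).
Proof.
move=> oU Hf; elim: (index_enum I) => [|i s IH].
  apply: (@Cn_ext _ _ _ _ (cst 0)) (Cn_cst _ _ _) => // x _.
  by rewrite big_nil.
apply: (@Cn_ext _ _ _ _ (fun x => f i x + \sum_(j <- s) f j x)) => //.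
  by move=> x _; rewrite big_cons.
exact: Cn_add.
Qed.

Lemma Cn_scale (V W : normedModType R) r (U : set V) (k : V -> R) (f : V -> W) :
  open U -> Cn r U k -> Cn r U f -> Cn r U (fun x => k x *: f x).
Proof.
move=> oU; elim: r k f => [|r IH] k f.
  by move=> ck cf x Ux; apply: cvgZ; [exact: ck|exact: cf].
move=> Ck Cf; have [dk Dk] := Ck; have [df Df] := Cf; split=> [x Ux|v].
  by have [] := is_diff_scale (dk x Ux) (df x Ux).
apply: (@Cn_ext _ _ _ _ (fun x => k x *: 'D_v f x + 'D_v k x *: f x)) => //.
  move=> x Ux; have [dd DD] := is_diff_scale (dk x Ux) (df x Ux).
  by rewrite (deriveE _ dd) DD (deriveE _ (dk x Ux)) (deriveE _ (df x Ux)).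
(* Each product pairs a derivative, of class [r], with an undifferentiated factor, which [CnS]
   lowers to the same class. *)
apply: Cn_add => //.
  by apply: IH; [exact: CnS|exact: Df].
by apply: IH; [exact: Dk|exact: CnS].
Qed.

Lemma Cn_linear_comp (V W X : normedModType R) r (U : set V) (f : V -> W)
  (l : {linear W -> X}) : open U -> continuous l ->
  Cn r U f -> Cn r U (l \o f).
Proof.
move=> oU cl; elim: r f => [|r IH] f.
  by move=> cf x Ux; apply: continuous_comp; [exact: cf|exact: cl].
move=> [df Df]; split=> [x Ux|v].
  by apply: differentiable_comp; [exact: df|exact: linear_differentiable].
apply: (@Cn_ext _ _ _ _ (l \o 'D_v f)) (IH _ (Df v)) => // x Ux.
have dl y : differentiable l y by exact: linear_differentiable.
have dfx := df x Ux.
rewrite /= (deriveE _ dfx) (deriveE _ (differentiable_comp dfx (dl _))).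
by rewrite (diff_comp dfx (dl _))/= diff_lin.
Qed.

(** Finite dimensionality in the form that the chain rule needs. [Cn] speaks of derivatives in fixed
    directions, whereas differentiating [f \o g] takes [f] in the moving direction ['D_v g x];
    coordinates turn this into a finite sum of fixed-direction derivatives with smooth
    coefficients. *)
Definition finite_coordinates (E : normedModType R) : Prop :=
  exists (I : finType) (e : I -> E) (c : I -> {linear E -> R}),
    (forall i, continuous (c i)) /\ (forall x, x = \sum_i c i x *: e i).

Lemma linear_finite_continuous (E W : normedModType R) (l : {linear E -> W}) :
  finite_coordinates E -> continuous l.
Proof.
move=> [I [e [c [cc ce]]]].
rewrite (_ : (l : E -> W) = fun x => \sum_i c i x *: l (e i)).
  move=> x; apply: (@Cn_continuous _ _ 0 setT) => //.
  apply: Cn_sum => [|i]; first exact: openT.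
  by move=> y _; apply: cvgZr_tmp; exact: cc.
apply/funext => x; rewrite {1}(ce x) linear_sum.
by apply: eq_bigr => i _; rewrite linearZ.
Qed.

Lemma Cn_comp (V E W : normedModType R) r (U : set V) (U' : set E)
    (g : V -> E) (f : E -> W) :
  finite_coordinates E -> open U -> (forall x, U x -> U' (g x)) ->
  Cn r U g -> Cn r U' f -> Cn r U (f \o g).
Proof.
move=> [I [e [c [cc ce]]]] oU UU'; elim: r f g UU' => [|r IH] f g UU' Cg Cf.
  by move=> x Ux; apply: continuous_comp; [exact: Cg|exact/Cf/UU'].
have [dg Dg] := Cg; have [df Df] := Cf; split=> [x Ux|v].
  by apply: differentiable_comp; [exact: dg|exact/df/UU'].
apply: (@Cn_ext _ _ _ _ (fun x => \sum_i c i ('D_v g x) *: 'D_(e i) f (g x))) => //.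
  move=> x Ux; have dgx := dg _ Ux; have dfx := df _ (UU' _ Ux).
  rewrite [RHS](deriveE _ (differentiable_comp dgx dfx)).
  rewrite (diff_comp dgx dfx)/= -(deriveE _ dgx) {2}[ 'D_v g x]ce linear_sum.
  by apply: eq_bigr => i _; rewrite linearZ /= (deriveE _ dfx).
apply: (@Cn_sum _ _ _ _ I (fun i x => c i ('D_v g x) *: 'D_(e i) f (g x))) => // i.
apply: Cn_scale => //.
  by apply: (@Cn_linear_comp _ _ _ _ _ ('D_v g) (c i)) => //; exact: Dg.
by apply: (IH ('D_(e i) f)) (Df _) => //; exact: CnS.
Qed.

Lemma finite_coordinates_real : finite_coordinates R.
Proof.
exists unit, (fun=> 1), (fun=> idfun); split=> [_ x|x]; first exact: cvg_id.
by rewrite big_const card_unit /= addr0 [_ *: _]mulr1.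
Qed.

Lemma finite_coordinates_rV n : finite_coordinates 'rV[R]_n.
Proof.
have lin i : linear (fun x : 'rV[R]_n => x 0 i) by move=> a u v; rewrite !mxE.
pose l i : {linear 'rV[R]_n -> R} :=
  HB.pack (fun x : 'rV[R]_n => x 0 i) (GRing.isLinear.Build _ _ _ _ _ (lin i)).
exists 'I_n, (fun i => delta_mx 0 i), l.
split=> [i|x]; first exact: coord_continuous.
exact: row_sum_delta.
Qed.

Lemma finite_coordinates_prod (E F : normedModType R) :
  finite_coordinates E -> finite_coordinates F -> finite_coordinates (E * F)%type.
Proof.
move=> [I [e [c [cc ce]]]] [J [e' [c' [cc' ce']]]].
have lin1 i : linear (fun x : E * F => c i x.1) by move=> a u v; rewrite linearP.
have lin2 j : linear (fun x : E * F => c' j x.2) by move=> a u v; rewrite linearP.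
pose l1 i : {linear (E * F)%type -> R} := HB.pack (fun x : E * F =>
  c i x.1) (GRing.isLinear.Build _ _ _ _ _ (lin1 i)).
pose l2 j : {linear (E * F)%type -> R} := HB.pack (fun x : E * F =>
  c' j x.2) (GRing.isLinear.Build _ _ _ _ _ (lin2 j)).
exists (I + J)%type.
exists (fun k => match k with inl i => (e i, 0) | inr j => (0, e' j) end).
exists (fun k => match k with inl i => l1 i | inr j => l2 j end); split.
  case=> i x; rewrite /continuous_at/=.
    by apply: (@continuous_comp _ _ _ fst (c i)); [exact: cvg_fst|exact: cc].
  by apply: (@continuous_comp _ _ _ snd (c' i)); [exact: cvg_snd|exact: cc'].
move=> [x y]; rewrite big_sumType/=.
have -> : \sum_i c i x *: (e i, 0 : F) = (x, 0).
  rewrite {2}(ce x); elim/big_rec2: _ => // i a b _ ->.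
  by congr pair; rewrite /= scaler0 add0r.
have -> : \sum_i c' i y *: (0 : E, e' i) = (0, y).
  rewrite {2}(ce' y); elim/big_rec2: _ => // i a b _ ->.
  by congr pair; rewrite /= scaler0 add0r.
by congr pair; rewrite /= ?addr0 ?add0r.
Qed.

End SmoothCalculus.

(** * Differentials on subsets *)

Section DifferentialOn.
Context {R : realType} {V W : normedModType R}.
Implicit Types (A : set V) (f F : V -> W) (x w : V) (l : {linear V -> W}).

Lemma has_differential_onP A f x l : has_differential_on A f x l <->
  continuous l /\ forall e, 0 < e ->
    \forall y \near x, A y -> `|f y - f x - l (y - x)| <= e * `|y - x|.
Proof.
split=> -[cl H]; split=> //.
  move=> e e0; move/cvgr0Pnorm_le: H => /(_ e e0).
  rewrite !near_withinE; apply: filterS => y H Ay.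
  have [->|yx] := eqVneq y x; first by rewrite !subrr linear0 subrr !normr0 mulr0.
  have := H yx Ay; rewrite normrZ normfV normr_id mulrC ler_pdivrMr//.
  by rewrite normr_gt0 subr_eq0.
apply/cvgr0Pnorm_le => e e0; rewrite !near_withinE.
apply: filterS (H e e0) => y {}H yx Ay.
rewrite normrZ normfV normr_id mulrC ler_pdivrMr ?H//.
by rewrite normr_gt0 subr_eq0.
Qed.

Lemma has_differential_on_extension A f F x :
  A x -> (forall y, A y -> F y = f y) -> differentiable F x ->
  has_differential_on A f x ('d F x).
Proof.
move=> Ax Ff dF; apply/has_differential_onP; split; first exact: diff_continuous.
move=> e e0; apply: filterS (differentiable_le dF e0) => y H Ay.
by rewrite -!Ff.
Qed.

(** Both linear maps approximate the same increments of [f] along a segment inside [A], so their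
    difference on [t *: w] is [o(t)]; by linearity it vanishes on [w]. *)
Lemma has_differential_on_unique A f x w l1 l2 :
  (forall t, 0 <= t <= 1 -> A (x + t *: w)) ->
  has_differential_on A f x l1 -> has_differential_on A f x l2 -> l1 w = l2 w.
Proof.
move=> Aw /has_differential_onP[_ H1] /has_differential_onP[_ H2].
have [->|w0] := eqVneq w 0; first by rewrite !linear0.
apply/eqP; rewrite -subr_eq0 -normr_le0; apply/ler_addgt0Pr => e e0; rewrite add0r.
(* Two errors of slope [d] add up to [(d + d) * |w| = e]. *)
pose d := e / (2 * `|w|).
have nw : 0 < `|w| by rewrite normr_gt0.
have d0 : 0 < d by rewrite divr_gt0// mulr_gt0.
have : \forall y \near x, A y -> `|l1 (y - x) - l2 (y - x)| <= (d + d) * `|y - x|.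
  apply: filterS2 (H1 _ d0) (H2 _ d0) => y {}H1 {}H2 Ay.
  rewrite mulrDl addrC (le_trans _ (lerD (H2 Ay) (H1 Ay)))//.
  by rewrite (le_trans _ (ler_normB _ _))// opprD addrACA subrr add0r opprK addrC.
move=> /nbhs_normP[r /= r0 Br].
(* The bound 1 keeps the point on the segment; the other one gives [t * |w| <= r / 2 < r]. *)
pose t := Num.min 1 (r / (2 * `|w|)).
have t0 : 0 < t by rewrite lt_min ltr01 divr_gt0// mulr_gt0.
have t1 : t <= 1 by rewrite ge_min lexx.
have tr : t * `|w| < r.
  have : t <= r / (2 * `|w|) by rewrite ge_min lexx orbT.
  rewrite ler_pdivlMr ?mulr_gt0// => h; nra.
have := Br (x + t *: w); rewrite /= opprD addrA subrr sub0r normrN normrZ gtr0_norm//.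
move=> /(_ tr (Aw t _)); rewrite (ltW t0) t1 => /(_ isT).
rewrite [x + _]addrC addrK (linearZ_LR l1)
  (linearZ_LR l2) /= -scalerBr !normrZ gtr0_norm// mulrCA ler_pM2l//.
move=> /le_trans; apply; rewrite le_eqVlt; apply/orP; left; apply/eqP.
by rewrite /d; field; exact: lt0r_neq0.
Qed.

End DifferentialOn.

(** The segment itself serves as the domain in the uniqueness lemma. Only one side of [x] is
    involved, so [x] may lie on the boundary of the set where [f] and [g] agree. *)
Lemma diff_eq_on_ray (R : realType) (V W : normedModType R) (f g : V -> W) x w :
  differentiable f x -> differentiable g x ->
  (forall t, 0 <= t <= 1 -> f (x + t *: w) = g (x + t *: w)) ->
  'd f x w = 'd g x w.
Proof.
move=> df dg fg; pose A := [set x + t *: w | t in `[0, 1]%classic].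
have Ax : A x by exists 0; rewrite /= ?scale0r ?addr0// in_itv /= lexx ler01.
apply: (@has_differential_on_unique _ _ _ A f x).
- by move=> t t01; exists t => //=; rewrite in_itv.
- exact: has_differential_on_extension.
- apply: has_differential_on_extension => // y [t]/=; rewrite in_itv /= => t01 <-.
  by rewrite fg.
Qed.

Section LinearMaps.
Context {R : realType}.

Lemma is_diff_linear (E W : normedModType R) (f : E -> W) (x : E) :
  finite_coordinates E -> linear f -> is_diff x f f.
Proof.
move=> fE lf; pose l : {linear E -> W} := HB.pack f (GRing.isLinear.Build _ _ _ _ _ lf).
have cl : continuous l by exact: linear_finite_continuous.
by apply: DiffDef; [exact: (linear_differentiable x cl)|exact: (diff_lin x cl)].
Qed.

Lemma continuous_of_linear (E W : normedModType R) (f : E -> W) :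
  finite_coordinates E -> linear f -> continuous f.
Proof.
move=> fE lf x; apply: differentiable_continuous.
by have [] := is_diff_linear x fE lf.
Qed.

Lemma Cn_of_linear (E W : normedModType R) r (U : set E) (f : E -> W) :
  finite_coordinates E -> linear f -> Cn r U f.
Proof.
move=> fE lf; pose l : {linear E -> W} := HB.pack f (GRing.isLinear.Build _ _ _ _ _ lf).
exact: (@Cn_linear _ _ _ _ _ l (continuous_of_linear fE lf)).
Qed.

Lemma Cn_comp_linear (V E W : normedModType R) r (U : set V) (g : V -> E) (f : E -> W) :
  finite_coordinates E -> linear f -> open U -> Cn r U g ->
  Cn r U (fun x => f (g x)).
Proof.
move=> fE lf oU Cg; pose l : {linear E -> W} := HB.pack f
  (GRing.isLinear.Build _ _ _ _ _ lf).
exact: (@Cn_linear_comp _ _ _ _ _ _ _ l oU (continuous_of_linear fE lf)).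
Qed.

Lemma Cn_pair (V E W : normedModType R) r (U : set V) (f : V -> E) (g : V -> W) :
  open U -> Cn r U f -> Cn r U g -> Cn r U (fun x => (f x, g x)).
Proof.
move=> oU; elim: r f g => [|r IH] f g.
  by move=> cf cg x Ux; apply: cvg_pair; [exact: cf|exact: cg].
move=> [df Df] [dg Dg]; split=> [x Ux|v].
  by apply: differentiable_pair; [exact: df|exact: dg].
apply: (@Cn_ext _ _ _ _ _ (fun x => ('D_v f x, 'D_v g x))) => //;
  last by apply: IH; [exact: Df|exact: Dg].
move=> x Ux; have dfx := df x Ux; have dgx := dg x Ux.
rewrite (deriveE _ (differentiable_pair dfx dgx)) diff_pair//=.
by rewrite (deriveE _ dfx) (deriveE _ dgx).
Qed.

Lemma diff_slice (E W : normedModType R) (f : E * R -> W) (x : E) (t : R) :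
  differentiable f (x, t) ->
  is_diff x (fun y => f (y, t)) (fun v => 'd f (x, t) (v, 0)).
Proof.
move=> df.
exact: (is_diff_comp (is_diff_pair (is_diff_id x) (is_diff_cst t x))
  (differentiableP df)).
Qed.

Lemma linear_eq_on_convex (V W : normedModType R) (A : set V) (f : V -> W) (x : V)
    (l1 l2 : {linear V -> W}) :
  (forall y z t, A y -> A z -> 0 <= t <= 1 -> A (y + t *: (z - y))) ->
  (forall v, exists2 e, 0 < e & A (e *: v)) -> A x ->
  has_differential_on A f x l1 -> has_differential_on A f x l2 -> l1 =1 l2.
Proof.
move=> cA aA Ax H1 H2.
have E y : A y -> l1 (y - x) = l2 (y - x).
  by move=> Ay; apply: (has_differential_on_unique _ H1 H2) => t t01; exact: cA.
(* Absorption of the zero vector puts the origin in [A]; comparing [l1] and [l2] on [0 - x] passes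
   from differences [y - x] to points [y] of [A]. *)
have Ex : l1 x = l2 x.
  have [e _] := aA 0; rewrite scaler0 => /E; rewrite sub0r !linearN; exact: oppr_inj.
move=> v; have [e e0 /E] := aA v.
rewrite !linearB Ex => /addIr; rewrite !linearZ /=.
by move=> /(scalerI (lt0r_neq0 e0)).
Qed.

End LinearMaps.

(** A continuous injection from a compact set to a Hausdorff space is closed, hence a homeomorphism
    onto its image. Off the image, [g] takes the default value [point]. *)
Lemma compact_injective_inverse (V : ptopologicalType) (W : topologicalType)
    (A : set V) (f : V -> W) :
  hausdorff_space W -> compact A -> {within A, continuous f} ->
  (forall x y, A x -> A y -> f x = f y -> x = y) ->
  exists g : W -> V, {within f @` A, continuous g} /\ (forall x, A x -> g (f x) = x).
Proof.
move=> hW cA cf fI; pose g p := xget point [set x | A x /\ f x = p].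
have gP x : A x -> g (f x) = x.
  move=> Ax; have [Ag fg] : A (g (f x)) /\ f (g (f x)) = f x.
    by apply: (@xgetPex _ point [set y | A y /\ f y = f x]); exists x.
  exact: fI.
exists g; split=> //; apply/subspace_continuousP => _ [x Ax <-];
  rewrite /from_subspace /= gP// => N Nx.
(* The part of [A] outside the interior of [N] has closed image, and this image misses [f x] by
   injectivity; its complement is the required neighbourhood of [f x]. *)
have cK : compact (A `&` ~` N^°).
  by apply: compact_closedI => //; apply: open_closedC; exact: open_interior.
have cfK : closed (f @` (A `&` ~` N^°)).
  apply: compact_closed => //; apply: continuous_compact => //.
  exact: continuous_subspaceW cf.
have : nbhs (f x) (~` (f @` (A `&` ~` N^°))).
  apply: open_nbhs_nbhs; split; first exact: closed_openC.
  by move=> [y [Ay NNy]] /(fI _ _ Ay Ax) yx; apply: NNy; rewrite yx.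
apply: filterS => q Kq [y Ay fyq]; rewrite -fyq /= gP//.
apply: contrapT => Ny; apply: Kq; exists y => //; split=> //.
by move=> /interior_subset.
Qed.

(** * Convexity and absorption for Euclidean disks *)

Section Disks.
Context {R : realType}.

Lemma diskE m (x : 'rV[R]_m) : disk m x <-> \sum_i x 0 i ^+ 2 <= 1.
Proof.
by rewrite /disk /euclidean_norm /= -{1}sqrtr1 ler_sqrt.
Qed.

Lemma disk_convex m (y z : 'rV[R]_m) (t : R) : disk m y -> disk m z ->
  0 <= t <= 1 -> disk m (y + t *: (z - y)).
Proof.
move=> /diskE y1 /diskE z1 /andP[t0 t1]; apply/diskE.
apply: (@le_trans _ _ (\sum_i ((1 - t) * y 0 i ^+ 2 + t * z 0 i ^+ 2))).
  apply: ler_sum => i _; rewrite !mxE -subr_ge0.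
  rewrite (_ : _ - _ = t * (1 - t) * (y 0 i - z 0 i) ^+ 2); last by ring.
  by rewrite mulr_ge0 ?sqr_ge0// mulr_ge0 ?subr_ge0.
rewrite big_split/= -!mulr_sumr; nra.
Qed.

Lemma disk_absorbing m (v : 'rV[R]_m) : exists2 e : R, 0 < e & disk m (e *: v).
Proof.
set S := \sum_i v 0 i ^+ 2.
have S0 : 0 <= S by apply: sumr_ge0 => i _; exact: sqr_ge0.
have S1 : 0 < 1 + S by rewrite ltr_pwDl.
(* This factor avoids both a square root and the case [v = 0]: the scaled sum of squares is
   [S / (1 + S)^2 <= 1]. *)
exists (1 + S)^-1; first by rewrite invr_gt0.
apply/diskE; under eq_bigr do rewrite mxE exprMn.
rewrite -mulr_sumr -/S exprVn mulrC ler_pdivrMr ?exprn_gt0// mul1r; nra.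
Qed.

End Disks.

(** * Splitting of coordinates *)

Section Coordinates.
Context {R : realType} {n k : nat} (hkn : (k <= n)%N).
Implicit Types (x v : 'rV[R]_n).
Local Notation m := (n - k)%N.

Definition join_coords (a : 'rV[R]_k) (b : 'rV[R]_m) : 'rV[R]_n :=
  castmx (erefl 1%N, subnKC hkn) (row_mx a b).

Lemma coords_fst_join a b : coords_fst hkn (join_coords a b) = a.
Proof. by rewrite /coords_fst /split_coords /join_coords castmx_comp castmx_id
  row_mxKl. Qed.

Lemma coords_snd_join a b : coords_snd hkn (join_coords a b) = b.
Proof. by rewrite /coords_snd /split_coords /join_coords castmx_comp castmx_id
  row_mxKr. Qed.

Lemma join_coordsK x : join_coords (coords_fst hkn x) (coords_snd hkn x) = x.
Proof. by rewrite /join_coords hsubmxK castmx_comp castmx_id. Qed.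

Lemma coords_inj x v : coords_fst hkn x = coords_fst hkn v ->
  coords_snd hkn x = coords_snd hkn v -> x = v.
Proof. by move=> e1 e2; rewrite -(join_coordsK x) e1 e2 join_coordsK. Qed.

Lemma coords_fst_linear : linear (@coords_fst R n k hkn).
Proof. by move=> a u v; apply/rowP => i; rewrite !(mxE, castmxE). Qed.

Lemma coords_snd_linear : linear (@coords_snd R n k hkn).
Proof. by move=> a u v; apply/rowP => i; rewrite !(mxE, castmxE). Qed.

Lemma join_coords_linear (a : R) (u1 v1 : 'rV[R]_k) (u2 v2 : 'rV[R]_m) :
  join_coords (a *: u1 + v1) (a *: u2 + v2) =
  a *: join_coords u1 u2 + join_coords v1 v2.
Proof.
by apply: coords_inj; rewrite ?coords_fst_linear ?coords_snd_linear
  ?coords_fst_join ?coords_snd_join.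
Qed.

Lemma sum_coords x v : \sum_i x 0 i * v 0 i =
  \sum_i coords_fst hkn x 0 i * coords_fst hkn v 0 i +
  \sum_i coords_snd hkn x 0 i * coords_snd hkn v 0 i.
Proof.
rewrite (reindex (cast_ord (subnKC hkn))) /=; last first.
  by exists (cast_ord (esym (subnKC hkn))) => i _; rewrite ?cast_ordK ?cast_ordKV.
rewrite big_split_ord /=; congr (_ + _); apply: eq_bigr => i _.
  by rewrite !mxE !castmxE /=; congr (x _ _ * v _ _); apply: val_inj.
by rewrite !mxE !castmxE /=; congr (x _ _ * v _ _); apply: val_inj.
Qed.

Lemma disk_prod_convex y z (t : R) : disk_prod hkn y -> disk_prod hkn z ->
  0 <= t <= 1 -> disk_prod hkn (y + t *: (z - y)).
Proof.
move=> [y1 y2] [z1 z2] t01; split.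
  rewrite (_ : coords_fst _ _ = coords_fst hkn y +
      t *: (coords_fst hkn z - coords_fst hkn y)); first exact: disk_convex.
  by apply/rowP => i; rewrite !(mxE, castmxE).
rewrite (_ : coords_snd _ _ = coords_snd hkn y +
    t *: (coords_snd hkn z - coords_snd hkn y)); first exact: disk_convex.
by apply/rowP => i; rewrite !(mxE, castmxE).
Qed.

(** The sum of squares splits along the two blocks, so the round disk of [R^n] lies inside the
    product. *)
Lemma disk_prod_absorbing v : exists2 e : R, 0 < e & disk_prod hkn (e *: v).
Proof.
have [e e0 /diskE de] := disk_absorbing v; exists e => //.
move: de; under eq_bigr do rewrite expr2; rewrite sum_coords => de.
by split; apply/diskE; apply: le_trans de; under eq_bigr do rewrite expr2;
  rewrite ?lerDl ?lerDr; apply: sumr_ge0 => i _; rewrite -expr2 sqr_ge0.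
Qed.

Lemma coords_fst_continuous : continuous (@coords_fst R n k hkn).
Proof. exact: continuous_of_linear (finite_coordinates_rV _) coords_fst_linear. Qed.

Lemma coords_snd_continuous : continuous (@coords_snd R n k hkn).
Proof. exact: continuous_of_linear (finite_coordinates_rV _) coords_snd_linear. Qed.

Lemma disk_closed p : closed (disk p : set 'rV[R]_p).
Proof.
rewrite (_ : disk p = (fun x : 'rV[R]_p => \sum_i x 0 i ^+ 2) @^-1` [set r | r <= 1]).
  apply: preimage_closed; last exact: closed_le.
  move=> x _; apply: (@Cn_continuous R 'rV[R]_p R 0 setT) => //.
  apply: (@Cn_sum _ _ _ _ _ _ (fun i (x : 'rV[R]_p) => x 0 i ^+ 2)).
    exact: openT.
  move=> i y _.
  apply: (@continuous_comp _ _ _ (fun x : 'rV[R]_p => x 0 i) (fun r => r ^+ 2)).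
    exact: coord_continuous.
  exact: exprn_continuous.
by apply/seteqP; split=> x /diskE.
Qed.

Lemma disk_prod_compact : compact (disk_prod hkn : set 'rV[R]_n).
Proof.
apply: bounded_closed_compact.
  (* The two blocks give a total sum of squares at most [1 + 1], so each coordinate has square at
     most 2 and absolute value at most 2. *)
  exists 2; split=> // M M2 x [/diskE x1 /diskE x2].
  have S2 : \sum_i x 0 i ^+ 2 <= 2.
    under eq_bigr do rewrite expr2; rewrite sum_coords.
    have -> : (2 : R) = 1 + 1 by [].
    by apply: lerD; under eq_bigr do rewrite -expr2.
  rewrite {1}/Num.norm /= mx_normrE; apply/bigmax_leP; split=> [|[i j] _ /=].
    by apply: ltW; apply: lt_trans M2.
  have xj : x i j ^+ 2 <= 2.
    rewrite (ord1 i); apply: le_trans S2; rewrite (bigD1 j)//= lerDl.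
    by apply: sumr_ge0 => ? _; exact: sqr_ge0.
  apply: ltW; apply: le_lt_trans M2; rewrite ler_norml; apply/andP; split; nra.
apply: closedI; apply: preimage_closed; try exact: disk_closed.
  by move=> x _; exact: coords_fst_continuous.
by move=> x _; exact: coords_snd_continuous.
Qed.

Lemma front_proj_linear : linear (@front_proj R n k hkn).
Proof.
move=> a [[x y] z] [[x' y'] z']; rewrite /front_proj /xcoord /ycoord /zcoord /=.
by rewrite !(coords_fst_linear, coords_snd_linear).
Qed.

(** The contact form is [alpha_(n-k)] minus the canonical one-form of [T^*R^k]. The forgotten
    coordinates [y_1, ..., y_k] enter only through the second term, which is how isotropy recovers
    them. *)
Lemma alpha_front_proj (p v : contact_space R n) :
  alpha p v = alpha (front_proj hkn p).2 (front_proj hkn v).2 -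
    \sum_i coords_fst hkn (ycoord p) 0 i * (front_proj hkn v).1 0 i.
Proof. by rewrite /alpha sum_coords /ycoord /xcoord /zcoord /= opprD addrCA addrC. Qed.

End Coordinates.

(** * The family of lifts *)

Section Suspension.
Context {R : realType} {n k : nat} (hkn : (k <= n)%N).
Local Notation m := (n - k)%N.
Context (F : 'rV[R]_m * R -> contact_space R m) (B : 'rV[R]_k -> R).
Implicit Types (p : 'rV[R]_n * R) (q : 'rV[R]_m * R) (s : 'rV[R]_k).

Definition gradient s : 'rV[R]_k := \row_i 'D_(delta_mx 0 i) B s.

Definition contact_hamiltonian q : R := alpha (F q) ('D_(0, 1) F q).

Definition isotopy_point p : 'rV[R]_m * R :=
  (coords_snd hkn p.1, (1 - p.2) * B (coords_fst hkn p.1)).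

(** Identifies [T^*R^k] times [R^(2(n-k)+1)] with [R^(2n+1)]. Being linear, it reduces smoothness of
    the lift to that of its components. *)
Definition assemble (u : ('rV[R]_k * 'rV[R]_k) * contact_space R m) :
    contact_space R n :=
  (join_coords hkn u.1.1 u.2.1.1, join_coords hkn u.1.2 u.2.1.2, u.2.2).

Definition suspension_family p : contact_space R n :=
  assemble ((coords_fst hkn p.1,
    ((1 - p.2) * contact_hamiltonian (isotopy_point p)) *:
      gradient (coords_fst hkn p.1)), F (isotopy_point p)).

Lemma front_proj_assemble u : front_proj hkn (assemble u) = (u.1.1, u.2).
Proof.
case: u => [[a b] [[x y] z]].
by rewrite /front_proj /xcoord /ycoord /zcoord /= coords_fst_join !coords_snd_join.
Qed.

Lemma assemble_linear : linear assemble.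
Proof.
move=> a [[a1 b1] [[x1 y1] z1]] [[a2 b2] [[x2 y2] z2]].
by rewrite /assemble /= !join_coords_linear.
Qed.

Lemma gradientE s (v : 'rV[R]_k) : differentiable B s ->
  \sum_i gradient s 0 i * v 0 i = 'd B s v.
Proof.
move=> dB; rewrite {2}[v]row_sum_delta linear_sum; apply: eq_bigr => i _.
by rewrite linearZ /= mxE (deriveE _ dB) mulrC.
Qed.

Lemma alpha_linear N (u : contact_space R N) : linear (alpha u).
Proof.
move=> a v w; rewrite /alpha /zcoord /xcoord /=.
under eq_bigr do rewrite !mxE mulrDr mulrCA.
rewrite big_split/= -mulr_sumr [_ *: _]mulrC [a *: _ in RHS]mulrBr.
by rewrite [v.2 * a]mulrC opprD addrACA.
Qed.

Lemma finite_coordinates_space N : finite_coordinates (contact_space R N).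
Proof.
apply: finite_coordinates_prod finite_coordinates_real.
by apply: finite_coordinates_prod; exact: finite_coordinates_rV.
Qed.

Lemma finite_coordinates_rV_real N : finite_coordinates ('rV[R]_N * R)%type.
Proof. exact: finite_coordinates_prod
  (finite_coordinates_rV _) finite_coordinates_real. Qed.

Lemma Cn_alpha (V : normedModType R) r (U : set V) N (f g : V -> contact_space R N) :
  open U -> Cn r U f -> Cn r U g -> Cn r U (fun x => alpha (f x) (g x)).
Proof.
move=> oU Cf Cg; have fN := finite_coordinates_space N.
apply: (Cn_add oU).
  by apply: (Cn_comp_linear (f := fun v : contact_space R N =>
    v.2) fN _ oU Cg) => ? [? ?] [? ?].
apply: (Cn_comp_linear (f := fun x : R => - x) finite_coordinates_real _ oU).
  by move=> a x y; rewrite opprD scalerN.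
apply: (@Cn_sum _ _ _ _ _ _ (fun i x => (f x).1.2 0 i * (g x).1.1 0 i)) => // i.
apply: (Cn_scale oU).
  by apply: (Cn_comp_linear (f := fun v : contact_space R N =>
    v.1.2 0 i) fN _ oU Cf) => a u v; rewrite !mxE.
by apply: (Cn_comp_linear (f := fun v : contact_space R N =>
  v.1.1 0 i) fN _ oU Cg) => a u v; rewrite !mxE.
Qed.

Section Smoothness.
Context (UF : set ('rV[R]_m * R)) (UB : set 'rV[R]_k).
Hypotheses (oF : open UF) (oB : open UB).
Hypotheses (CF : forall r, Cn r UF F) (CB : forall r, Cn r UB B).

Definition family_domain : set ('rV[R]_n * R) :=
  [set p | UB (coords_fst hkn p.1) /\ UF (isotopy_point p)].

Let fst_lin : linear (fun p : 'rV[R]_n * R => coords_fst hkn p.1).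
Proof. by move=> a u v; rewrite /= coords_fst_linear. Qed.

Let snd_lin : linear (fun p : 'rV[R]_n * R => coords_snd hkn p.1).
Proof. by move=> a u v; rewrite /= coords_snd_linear. Qed.

Lemma Cn_time_factor r (U : set ('rV[R]_n * R)) : open U -> Cn r U (fun p => 1 - p.2).
Proof.
move=> oU; apply: (Cn_add oU); first exact: Cn_cst.
apply: (@Cn_of_linear _ _ _ _ _ (fun p : 'rV[R]_n * R => - p.2)).
  exact: finite_coordinates_rV_real.
by move=> a u v; rewrite /= opprD scalerN.
Qed.

Lemma Cn_isotopy_point r (U : set ('rV[R]_n * R)) : open U ->
  (forall p, U p -> UB (coords_fst hkn p.1)) -> Cn r U isotopy_point.
Proof.
move=> oU UUB; apply: (Cn_pair oU).
  exact: Cn_of_linear (finite_coordinates_rV_real n) snd_lin.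
apply: (Cn_scale oU (Cn_time_factor r oU)).
apply: (Cn_comp (finite_coordinates_rV _) oU UUB _ (CB r)).
exact: Cn_of_linear (finite_coordinates_rV_real n) fst_lin.
Qed.

Lemma open_family_domain : open family_domain.
Proof.
(* Continuity of [isotopy_point] is available only where [B] is smooth, so the first condition is
   shown open before the second is pulled back. *)
pose U0 := [set p : 'rV[R]_n * R | UB (coords_fst hkn p.1)].
have oU0 : open U0.
  apply: open_comp => // p _.
  exact: (continuous_of_linear (finite_coordinates_rV_real n) fst_lin).
rewrite openE => p [pB pF]; rewrite /interior.
have cp : {for p, continuous isotopy_point}.
  by apply: (Cn_continuous (Cn_isotopy_point 0 oU0 _)) => //.
apply: filterI; first by apply: open_nbhs_nbhs; split.
by apply: cp; apply: open_nbhs_nbhs; split.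
Qed.

Lemma Cn_suspension_family r : Cn r family_domain suspension_family.
Proof.
have oU := open_family_domain; have fV := finite_coordinates_rV_real n.
have Cp r' : Cn r' family_domain isotopy_point.
  by apply: Cn_isotopy_point => // p [].
have Cs r' : Cn r' family_domain (fun p => coords_fst hkn p.1).
  exact: Cn_of_linear fV fst_lin.
have CFp (W : normedModType R) (f : _ -> W) r' : Cn r' UF f ->
    Cn r' family_domain (fun p => f (isotopy_point p)).
  move=> Cf; apply: (Cn_comp (finite_coordinates_rV_real _) oU _ (Cp r') Cf).
  by move=> p [].
apply: (Cn_comp_linear (f := assemble) _ assemble_linear oU).
  apply: finite_coordinates_prod (finite_coordinates_space _).
  by apply: finite_coordinates_prod; exact: finite_coordinates_rV.
apply: (Cn_pair oU); last exact: CFp.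
apply: (Cn_pair oU (Cs r)); apply: (Cn_scale oU).
  apply: (Cn_scale oU (Cn_time_factor r oU)).
  apply: (CFp _ (fun q => alpha (F q) ('D_(0, 1) F q))).
  (* The Hamiltonian costs one derivative of [F], and the gradient below one of [B]; hence the order
     [r.+1] in both places. *)
  apply: Cn_alpha => //; have [_ D] := CF r.+1; exact: D.
apply: (@Cn_ext _ _ _ _ _ (fun p => \sum_i
    'D_(delta_mx 0 i) B (coords_fst hkn p.1) *: (delta_mx 0 i : 'rV[R]_k))) => //.
  by move=> p _; rewrite [RHS]row_sum_delta; apply: eq_bigr => i _; rewrite mxE.
apply: (@Cn_sum _ _ _ _ _ _ (fun i p =>
    'D_(delta_mx 0 i) B (coords_fst hkn p.1) *: (delta_mx 0 i : 'rV[R]_k))) => // i.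
apply: (Cn_scale oU); last exact: Cn_cst.
have [_ D] := CB r.+1.
apply: (Cn_comp (finite_coordinates_rV _) oU _ (Cs r) (D _)).
by move=> p [].
Qed.

End Smoothness.
End Suspension.

(** * The contact form along the lift *)

Section Contact.
Context {R : realType} {n k : nat} (hkn : (k <= n)%N).
Local Notation m := (n - k)%N.
Context (F : 'rV[R]_m * R -> contact_space R m) (B : 'rV[R]_k -> R).
Local Notation Phi := (suspension_family hkn F B).
Local Notation pt := (isotopy_point hkn B).

Lemma is_diff_front_family (x : 'rV[R]_n) (t : R) :
  differentiable B (coords_fst hkn x) -> differentiable F (pt (x, t)) ->
  is_diff x (fun y => front_proj hkn (Phi (y, t)))
    (fun v => (coords_fst hkn v,
       'd F (pt (x, t)) (coords_snd hkn v, (1 - t) * 'd B (coords_fst hkn x)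
         (coords_fst hkn v)))).
Proof.
move=> dB dF.
have dfst := is_diff_linear x (finite_coordinates_rV _) (coords_fst_linear hkn).
have dsnd := is_diff_linear x (finite_coordinates_rV _) (coords_snd_linear hkn).
have dBx := is_diffZ (1 - t) (is_diff_comp dfst (differentiableP dB)).
have dp := is_diff_pair dsnd dBx.
have dFp := is_diff_comp dp (differentiableP (dF : differentiable F
  (coords_snd hkn x, _))).
have := is_diff_pair dfst dFp.
rewrite (_ : (fun y => front_proj hkn (Phi (y, t))) =
  (fun y => (coords_fst hkn y, F (pt (y, t)))))//.
by apply/funext => y; rewrite front_proj_assemble.
Qed.

Lemma front_proj_diff (x v : 'rV[R]_n) (t : R) :
  differentiable B (coords_fst hkn x) -> differentiable F (pt (x, t)) ->
  differentiable (fun y => Phi (y, t)) x ->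
  front_proj hkn ('d (fun y => Phi (y, t)) x v) =
  (coords_fst hkn v, 'd F (pt (x, t))
     (coords_snd hkn v, (1 - t) * 'd B (coords_fst hkn x) (coords_fst hkn v))).
Proof.
move=> dB dF dPhi; have [_ dE] := is_diff_front_family dB dF.
have dfp := is_diff_linear (Phi (x, t)) (finite_coordinates_space n)
  (front_proj_linear hkn).
have [_ dC] := is_diff_comp (differentiableP dPhi) dfp.
by have := congr1 (fun f => f v) dE; rewrite -/(_ \o _) dC /=.
Qed.

(** The cancellation that dictates the [y] coordinates: with [b] the derivative of [B] along the
    first block of [v], the motion of [psi] in time contributes [(1 - t) * b * H], and
    [y_1, ..., y_k] subtract exactly this. What survives is the contact form on a single slice of
    [F]. *)
Lemma alpha_suspension_diff (x v : 'rV[R]_n) (t : R) :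
  differentiable B (coords_fst hkn x) -> differentiable F (pt (x, t)) ->
  differentiable (fun y => Phi (y, t)) x ->
  alpha (Phi (x, t)) ('d (fun y => Phi (y, t)) x v) =
  alpha (F (pt (x, t))) ('d F (pt (x, t)) (coords_snd hkn v, 0)).
Proof.
move=> dB dF dPhi; rewrite (alpha_front_proj hkn) front_proj_diff//
  front_proj_assemble /=.
rewrite /ycoord /= coords_fst_join.
set q := pt (x, t); set c := 1 - t; set H := contact_hamiltonian F q.
set b := 'd B _ _.
(* Separates the pure time direction, which produces [H], from the direction tangent to the
   slice. *)
have -> : (coords_snd hkn v, c * b) = (c * b) *: (0, 1) + (coords_snd hkn v, 0).
  by congr pair; rewrite /= ?scaler0 ?add0r// addr0 [_ *: _]mulr1.
rewrite linearP alpha_linear.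
under eq_bigr do rewrite mxE -!mulrA.
rewrite -!mulr_sumr gradientE// -/b.
rewrite -(deriveE _ dF) -/(contact_hamiltonian F q) -/H [_ *: _]mulrAC mulrA.
by rewrite addrAC subrr add0r.
Qed.

End Contact.

Section LegendrianSlices.
Context {R : realType} {N : nat}.
Context (F psi : 'rV[R]_N * R -> contact_space R N) (th : 'rV[R]_N) (t : R).
Hypotheses (dth : disk N th) (t01 : unit_interval t).
Hypothesis (Fpsi : forall x, (disk N `*` @unit_interval R) x -> F x = psi x).
Hypothesis (dF : differentiable F (th, t)).

(** The Legendrian conditions on [psi] quantify over differentials along the disk. The spatial part
    of the differential of [F] is one of them, so the conditions can be read off [F]. *)
Lemma slice_has_differential : exists2 l : {linear 'rV[R]_N -> contact_space R N},
  has_differential_on (disk N) (fun x => psi (x, t)) th l &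
  forall w, l w = 'd F (th, t) (w, 0).
Proof.
have [dS SE] := diff_slice dF.
exists ('d (fun y => F (y, t)) th); last by move=> w; rewrite SE.
apply: has_differential_on_extension => // y dy; exact: Fpsi.
Qed.

Lemma slice_isotropic w : legendrian_embedding (disk N) (fun x => psi (x, t)) ->
  alpha (F (th, t)) ('d F (th, t) (w, 0)) = 0.
Proof.
move=> [_ _ _ iso]; have [l Hl lE] := slice_has_differential.
by rewrite -lE Fpsi//; exact: iso.
Qed.

Lemma slice_immersive w : legendrian_embedding (disk N) (fun x => psi (x, t)) ->
  'd F (th, t) (w, 0) = 0 -> w = 0.
Proof.
move=> [_ imm _ _]; have [l Hl lE] := slice_has_differential.
by rewrite -lE -(linear0 l) => /(imm _ _ dth Hl).
Qed.

End LegendrianSlices.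

Section TimeDerivative.
Context {R : realType} {N : nat}.

(* Constancy on one side suffices, so [u] may be an endpoint of [0, 1]. *)
Lemma diff_time_eq0 (F : 'rV[R]_N * R -> contact_space R N) th (u a : R) :
  a != 0 -> differentiable F (th, u) ->
  (forall t, 0 <= t <= 1 -> F (th, u + t * a) = F (th, u)) ->
  'D_(0, 1) F (th, u) = 0.
Proof.
move=> a0 dF FE.
have : 'd F (th, u) (0, a) = 0.
  pose G := cst (F (th, u)) : 'rV[R]_N * R -> contact_space R N.
  transitivity ('d G (th, u) (0, a)); last by rewrite /G diff_cst.
  apply: diff_eq_on_ray => // t t01.
  rewrite /G /= -(FE _ t01); congr F.
  by congr pair; rewrite /= scaler0 addr0.
rewrite (deriveE _ dF) (_ : (0, a) = a *: (0, 1)); last first.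
  by congr pair; rewrite /= ?scaler0// [_ *: _]mulr1.
by rewrite linearZ_LR => /eqP; rewrite scaler_eq0 (negPf a0) => /eqP.
Qed.

End TimeDerivative.

(** * Suspensions *)

Lemma linear_map0 (R : realType) (E W : normedModType R) (f : E -> W) :
  linear f -> f 0 = 0.
Proof.
move=> lf; pose l : {linear E -> W} := HB.pack f (GRing.isLinear.Build _ _ _ _ _ lf).
exact: (linear0 l).
Qed.

Lemma diff_eq_on_disk_prod (R : realType) (n k : nat) (hkn : (k <= n)%N)
    (W : normedModType R) (f g : 'rV[R]_n -> W) x :
  disk_prod hkn x -> differentiable f x -> differentiable g x ->
  (forall y, disk_prod hkn y -> f y = g y) -> 'd f x =1 'd g x.
Proof.
move=> dx df dg fg; apply: (@linear_eq_on_convex _ _ _ (disk_prod hkn) f x).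
- exact: disk_prod_convex.
- exact: disk_prod_absorbing.
- exact: dx.
- exact: has_differential_on_extension.
- by apply: has_differential_on_extension => // y /fg ->.
Qed.

Lemma smooth_on_differentiable (R : realType) (V W : normedModType R) (A : set V)
    (f : V -> W) x : smooth_on A f -> A x ->
  exists2 g, differentiable g x & forall y, A y -> g y = f y.
Proof.
move=> [U [g [oU AU Cg gf]]] Ax; exists g => //.
by have [dg _] := Cg 1%N; exact/dg/AU.
Qed.

(** Equal fronts with equal front velocities have equal [alpha_(n-k)] terms; these cancel and leave
    the pairing with [y_1, ..., y_k]. *)
Lemma alpha_front_proj_eq (R : realType) (n k : nat) (hkn : (k <= n)%N)
    (p1 p2 v1 v2 : contact_space R n) (w : 'rV[R]_k) :
  alpha p1 v1 = alpha p2 v2 -> front_proj hkn p1 = front_proj hkn p2 ->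
  front_proj hkn v1 = front_proj hkn v2 -> (front_proj hkn v2).1 = w ->
  \sum_i coords_fst hkn (ycoord p1) 0 i * w 0 i =
  \sum_i coords_fst hkn (ycoord p2) 0 i * w 0 i.
Proof.
move=> E ep ev <-; move: E.
rewrite (alpha_front_proj hkn p1) (alpha_front_proj hkn p2) ep ev.
by move=> /addrI /oppr_inj.
Qed.

(* The front of [L] fixes the front projection of its differential, whose first
   component is arbitrary, so isotropy determines [y_1, ..., y_k]. *)
Lemma suspension_unique (R : realType) (n k : nat) (hkn : (k <= n)%N) beta psi
    (L1 L2 : 'rV[R]_n -> contact_space R n) :
  is_suspension hkn beta psi L1 -> is_suspension hkn beta psi L2 ->
  forall x, disk_prod hkn x -> L1 x = L2 x.
Proof.
move=> [s1 i1 f1] [s2 i2 f2] x dx.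
have [F1 d1 F1E] := smooth_on_differentiable s1 dx.
have [F2 d2 F2E] := smooth_on_differentiable s2 dx.
have iso1 v : alpha (L1 x) ('d F1 x v) = 0.
  by apply: i1 => //; exact: has_differential_on_extension.
have iso2 v : alpha (L2 x) ('d F2 x v) = 0.
  by apply: i2 => //; exact: has_differential_on_extension.
have lfp (p : contact_space R n) := is_diff_linear p
  (finite_coordinates_space n) (front_proj_linear hkn).
have D1 := is_diff_comp (differentiableP d1) (lfp (F1 x)).
have D2 := is_diff_comp (differentiableP d2) (lfp (F2 x)).
have ff v : front_proj hkn ('d F1 x v) = front_proj hkn ('d F2 x v).
  have [D1d D1E] := D1; have [D2d D2E] := D2.
  have E : forall y, disk_prod hkn y -> (front_proj hkn \o F1) y =
    (front_proj hkn \o F2) y.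
    by move=> y dy; rewrite /= F1E// F2E// f1// f2.
  have E' := diff_eq_on_disk_prod dx D1d D2d E v.
  exact: etrans (esym (congr1 (@^~ v) D1E)) (etrans E' (congr1 (@^~ v) D2E)).
have lfst : linear (fun p : contact_space R n => (front_proj hkn p).1).
  by move=> a u v; rewrite front_proj_linear.
have ffst v : (front_proj hkn ('d F2 x v)).1 = coords_fst hkn v.
  have [D3d D3E] := is_diff_comp (differentiableP d2)
    (is_diff_linear (F2 x) (finite_coordinates_space n) lfst).
  have [D4d D4E] := is_diff_linear x (finite_coordinates_rV _) (coords_fst_linear hkn).
  have E : forall y, disk_prod hkn y ->
      ((fun p => (front_proj hkn p).1) \o F2) y = coords_fst hkn y.
    by move=> y dy; rewrite -[LHS]/((front_proj hkn (F2 y)).1) F2E// f2.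
  have E' := diff_eq_on_disk_prod dx D3d D4d E v.
  exact: etrans (esym (congr1 (@^~ v) D3E)) (etrans E' (congr1 (@^~ v) D4E)).
have fL : front_proj hkn (L1 x) = front_proj hkn (L2 x) by rewrite f1// f2.
have yE : coords_fst hkn (ycoord (L1 x)) = coords_fst hkn (ycoord (L2 x)).
  (* Moving in the direction [s_i] alone makes the pairing return the single coordinate [y_i]. *)
  apply/rowP => i; pose v := join_coords hkn (delta_mx 0 i : 'rV[R]_k) 0.
  have sumE (a : 'rV[R]_k) : \sum_j a 0 j * (delta_mx 0 i : 'rV[R]_k) 0 j = a 0 i.
    rewrite (bigD1 i)//= big1 ?addr0; first by rewrite mxE !eqxx mulr1.
    by move=> j ji; rewrite mxE (negPf ji) andbF mulr0.
  have := alpha_front_proj_eq (etrans (iso1 v) (esym (iso2 v))) fL (ff v) (ffst v).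
  by rewrite coords_fst_join !sumE.
move: fL yE; rewrite /front_proj /xcoord /ycoord /zcoord.
case: (L1 x) => [[a b] c]; case: (L2 x) => [[a' b'] c'] /= [e1 e2 e3 ->] e4.
by rewrite (coords_inj e1 e2) (coords_inj e4 e3).
Qed.

Lemma unit_intervalE (R : realType) (t : R) : unit_interval t = (0 <= t <= 1) :> Prop.
Proof. by rewrite /unit_interval /= in_itv. Qed.

(** * The Legendrian isotopy and its boundary values *)

Section Construction.
Context {R : realType} {n k : nat} (hkn : (k <= n)%N).
Local Notation m := (n - k)%N.
Context (F psi : 'rV[R]_m * R -> contact_space R m) (B beta : 'rV[R]_k -> R).
Context (UF : set ('rV[R]_m * R)) (UB : set 'rV[R]_k).
Hypotheses (oF : open UF) (oB : open UB).
Hypotheses (CF : forall r, Cn r UF F) (CB : forall r, Cn r UB B).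
Hypothesis (subF : disk m `*` @unit_interval R `<=` UF).
Hypothesis (subB : disk k `<=` UB).
Hypothesis (EF : forall x, (disk m `*` @unit_interval R) x -> F x = psi x).
Hypothesis (EB : forall s, disk k s -> B s = beta s).
Hypothesis (range : forall s, disk k s -> 0 <= beta s <= 1).
Hypothesis (leg : forall t, unit_interval t ->
  legendrian_embedding (disk m) (fun x => psi (x, t))).
Local Notation Phi := (suspension_family hkn F B).
Local Notation pt := (isotopy_point hkn B).

(** The time [(1 - t) * beta s] is a product of two numbers in [[0, 1]], so [F] is evaluated only
    where it equals [psi]. *)
Lemma isotopy_point_in x t : disk_prod hkn x -> unit_interval t ->
  (disk m `*` @unit_interval R) (pt (x, t)).
Proof.
move=> [x1 x2]; rewrite !unit_intervalE => /andP[t0 t1]; split=> //=.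
rewrite unit_intervalE EB//; have /andP[b0 b1] := range x1.
by apply/andP; split; nra.
Qed.

Lemma family_domain_in x t : disk_prod hkn x -> unit_interval t ->
  family_domain hkn B UF UB (x, t).
Proof.
move=> dx t01; split; first by apply: subB; case: dx.
exact/subF/isotopy_point_in.
Qed.

Lemma smooth_on_family : smooth_on (disk_prod hkn `*` @unit_interval R) Phi.
Proof.
exists (family_domain hkn B UF UB), Phi; split=> //.
- exact: open_family_domain.
- by move=> [x t] [dx t01]; exact: family_domain_in.
- by move=> r; exact: Cn_suspension_family.
Qed.

Lemma smooth_on_slice t : unit_interval t ->
  smooth_on (disk_prod hkn) (fun x => Phi (x, t)).
Proof.
move=> t01; pose U := [set x | family_domain hkn B UF UB (x, t)].
have Cj r (V : set 'rV[R]_n) : open V -> Cn r V (fun x => (x, t)).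
  move=> oV; apply: (Cn_pair oV); last exact: Cn_cst.
  exact: (@Cn_of_linear _ _ _ _ _ id (finite_coordinates_rV _)).
have oU : open U.
  have := @open_comp _ _ (fun x : 'rV[R]_n => (x, t)) (family_domain hkn B UF UB).
  apply; last exact: (open_family_domain oF oB CB).
  by move=> x _; exact: (Cn_continuous (Cj 0 setT openT)).
exists U, (fun x => Phi (x, t)); split=> //.
- by move=> x dx; exact: family_domain_in.
- move=> r; apply: (Cn_comp (finite_coordinates_rV_real n) oU _ (Cj r U oU)
    (Cn_suspension_family hkn oF oB CF CB r)).
  by [].
Qed.

Section Slice.
Context (x : 'rV[R]_n) (t : R).
Hypotheses (dx : disk_prod hkn x) (t01 : unit_interval t).

Lemma slice_dB : differentiable B (coords_fst hkn x).
Proof. by have [dB _] := CB 1; apply/dB/subB; case: dx. Qed.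

Lemma slice_dF : differentiable F (pt (x, t)).
Proof. by have [dF _] := CF 1; exact/dF/subF/isotopy_point_in. Qed.

Lemma slice_dPhi : differentiable (fun y => Phi (y, t)) x.
Proof.
have [dP _] := Cn_suspension_family hkn oF oB CF CB 1.
by have [] := diff_slice (dP _ (family_domain_in dx t01)).
Qed.

(** Being immersive or isotropic is a condition on every differential along the domain; this reduces
    both to the one that has been computed. *)
Lemma slice_differential_unique (l : {linear 'rV[R]_n -> contact_space R n}) :
  has_differential_on (disk_prod hkn) (fun y => Phi (y, t)) x l ->
  l =1 'd (fun y => Phi (y, t)) x.
Proof.
move=> Hl; apply: (linear_eq_on_convex _ _ dx Hl).
- exact: disk_prod_convex.
- exact: disk_prod_absorbing.
- by apply: has_differential_on_extension => //; exact: slice_dPhi.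
Qed.

End Slice.

Lemma slice_legendrian t : unit_interval t ->
  legendrian_embedding (disk_prod hkn) (fun x => Phi (x, t)).
Proof.
move=> t01; split; first exact: smooth_on_slice.
- move=> x l dx /(slice_differential_unique dx t01) lE.
  have [pt1 pt2] := isotopy_point_in dx t01.
  suff K v : l v = 0 -> v = 0.
    by move=> u v uv; apply/subr0_eq/K; rewrite linearB uv subrr.
  have D := front_proj_diff v (slice_dB dx) (slice_dF dx t01) (slice_dPhi dx t01).
  move=> lv0.
  have d0 : 'd (fun y => Phi (y, t)) x v = 0 by rewrite -lE.
  rewrite d0 in D.
  have f0 : front_proj hkn (0 : contact_space R n) = 0.
    exact: (linear_map0 (E := contact_space R n) (front_proj_linear hkn)).
  have := etrans (esym D) f0.
  (* The front records [s], so [v] has no [s] component. Then the time component also vanishes, and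
     immersivity of one slice of [psi] applies to the rest. *)
  move=> [v1]; rewrite v1 linear0 mulr0 => dF0.
  have v2 : coords_snd hkn v = 0.
    apply: (@slice_immersive _ _ F psi (pt (x, t)).1 (pt (x, t)).2) => //.
    - exact: slice_dF.
    - exact: leg.
  apply: (@coords_inj _ _ _ hkn).
    by rewrite v1 (linear_map0 (coords_fst_linear hkn)).
  by rewrite v2 (linear_map0 (coords_snd_linear hkn)).
- have cPhi : {within disk_prod hkn, continuous (fun x => Phi (x, t))}.
    apply: continuous_in_subspaceT => x; rewrite inE => dx.
    exact/differentiable_continuous/slice_dPhi.
  split=> //; apply: compact_injective_inverse => //.
  + exact: disk_prod_compact.
  + move=> x y dx dy /(congr1 (front_proj hkn)).
    rewrite !front_proj_assemble /= => -[e1 e2].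
    apply: (coords_inj e1).
    (* Equal [s] means equal time [(1 - t) * beta s], so both points come from the same embedded
       slice, whose left inverse [g] recovers [theta]. *)
    have ix := isotopy_point_in dx t01; have iy := isotopy_point_in dy t01.
    have [_ _ [_ [g [_ gK]]] _] := leg ix.2.
    have [ix1 _] := ix; have [iy1 _] := iy.
    rewrite -[LHS](gK _ ix1) -[RHS](gK _ iy1); congr g.
    have ptE : pt (y, t) = ((pt (y, t)).1, (pt
      (x, t)).2) by rewrite /isotopy_point /= e1.
    by rewrite -ptE -(EF iy) -e2 (EF ix).
- move=> x l dx /(slice_differential_unique dx t01) lE v; rewrite lE.
  rewrite alpha_suspension_diff; [|exact: slice_dB|exact: slice_dF|exact: slice_dPhi].
  have [pt1 pt2] := isotopy_point_in dx t01.
  apply: (@slice_isotropic _ _ F psi (pt (x, t)).1 (pt (x, t)).2) => //.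
    exact: slice_dF.
  exact: leg.
Qed.

Hypothesis (start : starts_at_inclusion psi).

(** The factor [1 - p.2] vanishes, which sets both the time of [psi] and the block [y_1, ..., y_k]
    to 0. *)
Lemma suspension_family_at1 x : disk_prod hkn x -> Phi (x, 1) = std_inclusion x.
Proof.
move=> dx; have [_ x2] := dx.
have ptE : pt (x, 1) = (coords_snd hkn x, 0) by rewrite /isotopy_point /= subrr mul0r.
rewrite /suspension_family ptE EF; last by split=> //=;
  rewrite unit_intervalE lexx ler01.
rewrite start// /= subrr mul0r scale0r /assemble /= join_coordsK.
rewrite /std_inclusion; congr (_, _, _).
by apply: (@coords_inj _ _ _ hkn);
  rewrite ?coords_fst_join ?coords_snd_join linear_map0//;
  [exact: coords_fst_linear|exact: coords_snd_linear].
Qed.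

Hypothesis (near_bdry : identity_near_boundary psi).
Hypothesis (near_ends : time_independent_near_ends psi).
Hypothesis (beta_bdry : forall s, sphere k s -> beta s = 0).

(** The step [a] may have either sign, so that the segment from [u] can point into [[0, 1]], where
    [F] is known to equal [psi]. *)
Lemma contact_hamiltonian_eq0 th (u a : R) : disk m th -> unit_interval u ->
  a != 0 -> unit_interval (u + a) ->
  (forall t, 0 <= t <= 1 -> psi (th, u + t * a) = psi (th, u)) ->
  contact_hamiltonian F (th, u) = 0.
Proof.
move=> dth u01 a0 ua01 H.
have dF : differentiable F (th, u) by have [dF _] := CF 1; exact/dF/subF.
rewrite /contact_hamiltonian (diff_time_eq0 a0 dF).
  by rewrite /alpha big1 ?subr0// => i _; rewrite mxE mulr0.
move=> t t01; rewrite !EF//= ?H//; split=> //=.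
move: u01 ua01 t01; rewrite !unit_intervalE.
move=> /andP[u0 u1] /andP[ua0 ua1] /andP[t0 t1].
by apply/andP; split; nra.
Qed.

Lemma suspension_family_boundary x t : disk_prod_boundary hkn x -> unit_interval t ->
  Phi (x, t) = Phi (x, 0).
Proof.
have i0 : unit_interval (0 : R) by rewrite unit_intervalE lexx ler01.
move=> [dx bx] t01.
(* The common value is written without reference to time, with zero block [y_1, ..., y_k]. *)
suff PhiE t' : unit_interval t' -> Phi (x, t') =
    assemble hkn ((coords_fst hkn x, 0), psi (coords_snd hkn x, 0)).
  by rewrite !PhiE.
clear t t01; move: t' => t t01; have [x1 x2] := dx.
have ix := isotopy_point_in dx t01.
have psi0 : psi (pt (x, t)) = psi (coords_snd hkn x, 0) /\
    contact_hamiltonian F (pt (x, t)) = 0.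
  case: bx => [s1|th1].
    have -> : pt (x, t) = (coords_snd hkn x, 0).
      by rewrite /isotopy_point /= EB// beta_bdry// mulr0.
    split=> //; have [e e0 He] := near_ends.
    (* The segment from 0 must lie in the stationary range, of length [e], and also in [[0, 1]],
       since [e] may exceed 1. *)
    pose a := Num.min e 1.
    have a0 : 0 < a by rewrite lt_min e0 ltr01.
    have ae : a <= e by rewrite ge_min lexx.
    have a1 : a <= 1 by rewrite ge_min lexx orbT.
    apply: (contact_hamiltonian_eq0 (a := a)) => //; first exact: lt0r_neq0.
      by rewrite unit_intervalE add0r (ltW a0) a1.
    move=> r /andP[r0 r1]; rewrite add0r.
    have ra0 : 0 <= r * a by rewrite mulr_ge0// ltW.
    have ra : r * a <= a by rewrite ger_pMl.
    have ra01 : unit_interval (r * a) by rewrite unit_intervalE ra0 (le_trans ra).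
    have [H _] := He _ _ x2 ra01.
    exact/H/(le_trans ra).
  have [U [oU sU HU]] := near_bdry.
  have psiE u : unit_interval u -> psi (coords_snd hkn x, u) = std_inclusion
    (coords_snd hkn x).
    by move=> u01; apply: HU => //; exact: sU.
  have [_ ix2] := ix; split; first by rewrite [pt _]surjective_pairing !psiE.
  rewrite [pt _]surjective_pairing.
  have /andP[u0 u1] : 0 <= (pt (x, t)).2 <= 1 by move: ix2; rewrite unit_intervalE.
  set u := (pt (x, t)).2 in u0 u1 ix2 *.
  (* Here [psi] is constant in time on all of [[0, 1]]; a step of one half towards the farther end
     stays in the interval. *)
  have [uh|uh] := leP u 2^-1.
    apply: (contact_hamiltonian_eq0 (a := 2^-1)) => //.
      by rewrite unit_intervalE; apply/andP; split; lra.
    move=> r /andP[r0 r1]; rewrite !psiE//.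
    by rewrite unit_intervalE; apply/andP; split; nra.
  apply: (contact_hamiltonian_eq0 (a := - 2^-1)) => //.
    by rewrite unit_intervalE; apply/andP; split; lra.
  move=> r /andP[r0 r1]; rewrite !psiE//.
  by rewrite unit_intervalE; apply/andP; split; nra.
have [psiE HE] := psi0.
by rewrite /suspension_family HE mulr0 scale0r EF// psiE.
Qed.

Lemma suspension_family_is_suspension :
  is_suspension hkn beta psi (fun x => Phi (x, 0)).
Proof.
have i0 : unit_interval (0 : R) by rewrite unit_intervalE lexx ler01.
have [sm _ _ iso] := slice_legendrian i0; split=> // x dx.
rewrite front_proj_assemble /= EF; last exact: isotopy_point_in.
by rewrite /isotopy_point /= subr0 mul1r EB//; case: dx.
Qed.

End Construction.

Theorem proposition1p1 (R : realType) (n k : nat) (hkn : (k <= n)%N)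
    (beta : 'rV[R]_k -> R) (hbeta : bump_function beta)
    (psi : 'rV[R]_(n - k) * R -> contact_space R (n - k))
    (hiso : legendrian_isotopy (disk (n - k)) psi)
    (hstart : starts_at_inclusion psi)
    (hbdry : identity_near_boundary psi)
    (hends : time_independent_near_ends psi) :
  exists Sigma : 'rV[R]_n -> contact_space R n,
    [/\ is_suspension hkn beta psi Sigma,
        forall Sigma', is_suspension hkn beta psi Sigma' ->
          forall x, disk_prod hkn x -> Sigma' x = Sigma x,
        legendrian_embedding (disk_prod hkn) Sigma
      & legendrian_isotopic_rel (disk_prod hkn) (disk_prod_boundary hkn)
          Sigma std_inclusion].
Proof.
have [[UF [F [oF subF CF EF]]] leg] := hiso.
have [[UB [B [oB subB CB EB]]] range _ _ _ _ bd] := hbeta.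
have i0 : unit_interval (0 : R) by rewrite unit_intervalE lexx ler01.
have susp := suspension_family_is_suspension hkn oF oB CF CB subF subB EF EB range leg.
have legS := slice_legendrian hkn oF oB CF CB subF subB EF EB range leg.
exists (fun x => suspension_family hkn F B (x, 0)); split.
- exact: susp.
- by move=> L HL; exact: suspension_unique HL susp.
- exact: legS.
exists (suspension_family hkn F B); split=> //.
- split; last by move=> t t01; exact: legS.
  exact: (smooth_on_family hkn oF oB CF CB subF subB EB range).
- by move=> x; apply: (suspension_family_at1 B EF hstart).
- by move=> x t; apply: (suspension_family_boundary CF subF EF EB range hbdry hends bd).
Qed.
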